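(* Let $N\ge1$ source domains and one target domain with latent representation $\mathbf{z}\in\mathcal{Z}\subset\mathbb{R}^n$ and polar coordinates $(r,\boldsymbol{\phi})=g(\mathbf{z})$ be given. Assume: (i) (angular invariance) $p(\boldsymbol{\phi}\mid Y=y,D=d)=p^t(\boldsymbol{\phi}\mid Y=y)$ for all $d=1,\dots,N$ and all classes $y$; (ii) (maximum entropy norm distribution) conditionally on $Y=y$ and $\boldsymbol{\phi}$, the target norm is uniformly distributed on $[\alpha_{y,\boldsymbol{\phi}},\beta_{y,\boldsymbol{\phi}}]$ with $\delta_{y,\boldsymbol{\phi}}=\beta_{y,\boldsymbol{\phi}}-\alpha_{y,\boldsymbol{\phi}}>0$, i.e. $p^t(r\mid\boldsymbol{\phi},y)=1/\delta_{y,\boldsymbol{\phi}}$ there, and the norm in the $d$-th source domain is exponentially distributed with mean $\mu_{d,y,\boldsymbol{\phi}}>0$, i.e. $p(r\mid\boldsymbol{\phi},d,y)=\frac{1}{\mu_{d,y,\boldsymbol{\phi}}}\exp(-r/\mu_{d,y,\boldsymbol{\phi}})$ for $r\ge0$. Then, for $r\in[\alpha_{y,\boldsymbol{\phi}},\beta_{y,\boldsymbol{\phi}}]$, the ratio $w(r\mid\boldsymbol{\phi},d,y)=p^t(r\mid\boldsymbol{\phi},y)/p(r\mid\boldsymbol{\phi},d,y)$ equals $$w(r\mid\boldsymbol{\phi},d,y)=\frac{\mu_{d,y,\boldsymbol{\phi}}\exp\!\left(r/\mu_{d,y,\boldsymbol{\phi}}\right)}{\delta_{y,\boldsymbol{\phi}}}\approx\frac{\mu_{d,y,\boldsymbol{\phi}}+r}{\delta_{y,\boldsymbol{\phi}}},$$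 where $\approx$ means that the right-hand expression is the first-order Maclaurin polynomial in $r$ of the middle expression.
   Context: Setting: $Y\in\{1,\dots,C\}$ is the class label. There are $N$ source distributions, indexed by $D=d\in\{1,\dots,N\}$, and one target distribution (superscript $t$); a feature map sends inputs to $\mathbf{z}\in\mathcal{Z}\subset\mathbb{R}^n$ and the push-forward laws have densities. $g(z_1,\dots,z_n)=(r,\boldsymbol{\phi})$, $\boldsymbol{\phi}=(\phi_1,\dots,\phi_{n-1})$, is the $n$-dimensional polar (hyperspherical) reparametrization, with $r=\|\mathbf{z}\|_2\ge0$ (so $\alpha_{y,\boldsymbol{\phi}}\ge0$). $p(\boldsymbol{\phi}\mid\cdot)$ is the density of the angular coordinates, $p(r\mid\boldsymbol{\phi},\cdot)$ the conditional density of the norm given the angles. The ratio $w$ is defined by $$w(r\mid\boldsymbol{\phi},d,y)=\frac{p^t(r\mid\boldsymbol{\phi},y)}{p(r\mid\boldsymbol{\phi},d,y)},$$ which under angular invariance also equals $p^t(\mathbf{z}\mid y)/p(\mathbf{z}\mid d,y)$ wherever this is defined. *)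

(* Defs.v *)
From HB Require Import structures.
From mathcomp Require Import all_boot all_order all_algebra.
From mathcomp Require Import zify ring lra.
From mathcomp Require Import all_classical all_reals all_analysis.

Set Implicit Arguments.
Unset Strict Implicit.
Unset Printing Implicit Defensive.

Import Order.TTheory GRing.Theory Num.Def Num.Theory.
Import numFieldNormedType.Exports.

Local Open Scope classical_set_scope.
Local Open Scope ring_scope.

(* Lebesgue measure on R^n, with R^n represented by n.-tuple R. *)
Section lebesgue_tuple.
Context {R : realType}.

Section step.
Variables (n : nat) (m : {sigma_finite_measure set (n.-tuple R) -> \bar R}).

Definition cons_pair (x : R * n.-tuple R) : n.+1.-tuple R :=
  [the n.+1.-tuple R of x.1 :: x.2].

Lemma measurable_cons_pair : measurable_fun setT cons_pair.
Proof.
by apply: (@measurable_cons _ _ _ _ fst n snd);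
  [exact: measurable_fst|exact: measurable_snd].
Qed.

Definition lebesgue_cons : set (n.+1.-tuple R) -> \bar R :=
  pushforward (@lebesgue_measure R \x m)%E cons_pair.

Let lebesgue_cons0 : lebesgue_cons set0 = 0%E.
Proof. by rewrite /lebesgue_cons /pushforward preimage_set0 measure0. Qed.

Let lebesgue_cons_ge0 A : (0 <= lebesgue_cons A)%E.
Proof. by rewrite /lebesgue_cons /pushforward; exact: measure_ge0. Qed.

Let lebesgue_cons_sigma_additive : semi_sigma_additive lebesgue_cons.
Proof.
move=> F mF tF mUF.
have mcF k : measurable (cons_pair @^-1` F k).
  by rewrite -[X in measurable X]setTI; exact: measurable_cons_pair.
rewrite /lebesgue_cons /pushforward preimage_bigcup.
apply: measure_semi_sigma_additive => //.
- apply/trivIsetP => i j _ _ ij; rewrite -preimage_setI.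
  by move/trivIsetP : tF => ->//; rewrite preimage_set0.
- by apply: bigcup_measurable => k _; exact: mcF.
Qed.

HB.instance Definition _ := isMeasure.Build _ _ _ lebesgue_cons
  lebesgue_cons0 lebesgue_cons_ge0 lebesgue_cons_sigma_additive.

Lemma lebesgue_cons_sigma_finite : sigma_finite setT lebesgue_cons.
Proof.
have /sigma_finiteP[F [TF ndF mF]] := sigma_finiteT (@lebesgue_measure R).
have /sigma_finiteP[G [TG ndG mG]] := sigma_finiteT m.
pose h (t : n.+1.-tuple R) : R * n.-tuple R := (thead t, [tuple of behead t]).
have mh : measurable_fun setT h.
  apply: measurable_fun_pair => /=.
    exact: (measurable_tnth (ord0 : 'I_n.+1)).
  exact: measurable_behead.
have hK : cancel cons_pair h.
  by move=> -[x t]; rewrite /h /cons_pair /= theadE; congr pair; exact: val_inj.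
exists (fun k => h @^-1` (F k `*` G k)).
  apply/seteqP; split => // t _.
  have [i _ Fi] : (\bigcup_k F k) (h t).1 by rewrite -TF.
  have [j _ Gj] : (\bigcup_k G k) (h t).2 by rewrite -TG.
  exists (maxn i j) => //; split.
    by move: Fi; exact/subsetPset/ndF/leq_maxl.
  by move: Gj; exact/subsetPset/ndG/leq_maxr.
move=> k; have [mFk Fk] := mF k; have [mGk Gk] := mG k; split.
  by rewrite -[X in measurable X]setTI; apply: mh => //; exact: measurableX.
rewrite /lebesgue_cons /pushforward -comp_preimage.
rewrite (_ : (h \o cons_pair) @^-1` _ = F k `*` G k); last first.
  by rewrite (_ : h \o cons_pair = id)//; apply/funext => x /=; rewrite hK.
by rewrite product_measure1E// lte_mul_pinfty// ge0_fin_numE.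
Qed.

HB.instance Definition _ :=
  Measure_isSigmaFinite.Build _ _ _ lebesgue_cons lebesgue_cons_sigma_finite.

End step.

Fixpoint lebesgue_tuple (n : nat) :
    {sigma_finite_measure set (n.-tuple R) -> \bar R} :=
  match n with
  | 0 => \d_ [tuple]
  | m.+1 => lebesgue_cons (lebesgue_tuple m)
  end.

End lebesgue_tuple.

Section polar_coordinates.
Context {R : realType} {n : nat}.
Implicit Types (z : n.-tuple R) (phi : n.-1.-tuple R).

Definition tail_norm z (i : nat) : R :=
  Num.sqrt (\sum_(i <= j < n) z`_j ^+ 2).

(* Coordinates are numbered from 0, so n - 2 is the index of the last angle.
   Where tail_norm z i = 0 the angle is undetermined, and the convention
   x / 0 = 0 picks pi / 2. *)
Definition polar_angle z (i : nat) : R :=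
  let a := acos (z`_i / tail_norm z i) in
  if (i.+2 == n) && (z`_i.+1 < 0) then 2 * pi - a else a.

Definition polar z : R * n.-1.-tuple R :=
  (tail_norm z 0, [tuple polar_angle z i | i < n.-1]).

(* z_1 = r cos phi_1, z_2 = r sin phi_1 cos phi_2, ...,
   z_(n-1) = r sin phi_1 ... sin phi_(n-2) cos phi_(n-1),
   z_n     = r sin phi_1 ... sin phi_(n-2) sin phi_(n-1). *)
Definition of_polar (x : R * n.-1.-tuple R) : n.-tuple R :=
  [tuple x.1 * (\prod_(j < i) sin x.2`_j) *
         (if (i.+1 < n)%N then cos x.2`_i else 1) | i < n].

Definition angle_domain : set (n.-1.-tuple R) :=
  [set phi | forall i : 'I_n.-1,
    if i.+2 == n then 0 <= phi`_i < 2 * pi else 0 <= phi`_i <= pi].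

Lemma tail_norm_ge0 z i : 0 <= tail_norm z i.
Proof. exact: sqrtr_ge0. Qed.

Lemma sqr_tail_norm z i : (i < n)%N ->
  tail_norm z i ^+ 2 = z`_i ^+ 2 + tail_norm z i.+1 ^+ 2.
Proof.
by move=> i_n; rewrite /tail_norm !sqr_sqrtr ?sumr_ge0// => [|? _|? _];
  [rewrite big_ltn|exact: sqr_ge0..].
Qed.

Lemma tail_norm_ratio z i : (i < n)%N ->
  -1 <= z`_i / tail_norm z i <= 1.
Proof.
move=> i_n; rewrite -ler_norml normrM normfV (ger0_norm (tail_norm_ge0 _ _)).
have [->|r0] := eqVneq (tail_norm z i) 0; first by rewrite invr0 mulr0.
rewrite ler_pdivrMr ?lt_def ?r0 ?tail_norm_ge0// mul1r.
rewrite -(@ler_pXn2r _ 2) ?nnegrE ?tail_norm_ge0// real_normK ?num_real//.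
by rewrite sqr_tail_norm// lerDl sqr_ge0.
Qed.

Lemma tail_norm_cos z i : (i < n)%N ->
  tail_norm z i * cos (acos (z`_i / tail_norm z i)) = z`_i.
Proof.
move=> i_n; rewrite acosK ?in_itv/= ?tail_norm_ratio//.
have [r0|r0] := eqVneq (tail_norm z i) 0; last by rewrite mulrCA divff ?mulr1.
apply/eqP; rewrite r0 mul0r eq_sym -sqrf_eq0.
have /eqP := sqr_tail_norm z i_n.
by rewrite r0 expr0n/= eq_sym paddr_eq0 ?sqr_ge0// => /andP[].
Qed.

Lemma tail_norm_sin z i : (i < n)%N ->
  tail_norm z i * sin (acos (z`_i / tail_norm z i)) = tail_norm z i.+1.
Proof.
move=> i_n; rewrite sin_acos ?tail_norm_ratio//.
have [r0|r0] := eqVneq (tail_norm z i) 0.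
  apply/eqP; rewrite r0 mul0r eq_sym -sqrf_eq0.
  have /eqP := sqr_tail_norm z i_n.
  by rewrite r0 expr0n/= eq_sym paddr_eq0 ?sqr_ge0// => /andP[].
have ratio2 : 0 <= 1 - (z`_i / tail_norm z i) ^+ 2.
  have := tail_norm_ratio z i_n; rewrite -ler_norml => ratio_le1.
  by rewrite subr_ge0 -real_normK ?num_real// exprn_ile1.
apply/eqP; rewrite -(@eqrXn2 _ 2) ?mulr_ge0 ?sqrtr_ge0//.
rewrite exprMn (sqr_sqrtr ratio2).
rewrite mulrBr mulr1 -exprMn (mulrC (_ i)) divfK//.
by rewrite sqr_tail_norm// addrAC subrr add0r.
Qed.

Lemma nth_polar_angle z i : (i < n.-1)%N -> (polar z).2`_i = polar_angle z i.
Proof.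
by move=> i_n; rewrite -[i]/(nat_of_ord (Ordinal i_n)) -tnth_nth tnth_mktuple.
Qed.

Lemma polar_prod z i : (i.+1 < n)%N ->
  (polar z).1 * \prod_(j < i) sin (polar z).2`_j = tail_norm z i.
Proof.
elim: i => [|i IHi] i_n; first by rewrite big_ord0 mulr1.
rewrite big_ord_recr mulrA IHi 1?ltnW// nth_polar_angle; last first.
  by rewrite /=; lia.
by rewrite /polar_angle (ltn_eqF i_n) andFb tail_norm_sin//= ltnW// ltnW.
Qed.

Lemma polarK z : (1 < n)%N -> of_polar (polar z) = z.
Proof.
move=> n_gt1; apply: eq_from_tnth => i; rewrite tnth_mktuple (tnth_nth 0).
case: ifPn => [i_n|].
  rewrite polar_prod// nth_polar_angle; last by lia.
  rewrite /polar_angle; case: ifP => _; last by rewrite tail_norm_cos// ltnW.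
  by rewrite mulr_natl cosB cos2pi sin2pi mul1r mul0r addr0 tail_norm_cos// ltnW.
rewrite -leqNgt => n_i; have iE : i = n.-2.+1 :> nat by have := ltn_ord i; lia.
have zi : tail_norm z i = `|z`_i|.
  rewrite /tail_norm big_ltn// big_geq ?addr0 ?sqrtr_sqr//.
rewrite mulr1 iE big_ord_recr mulrA polar_prod; last by lia.
rewrite nth_polar_angle; last by rewrite /=; lia.
rewrite /polar_angle (_ : n.-2.+2 == n); last by lia.
rewrite [nat_of_ord ord_max]/= -iE; case: ifPn => /= zi0.
  rewrite mulr_natl sinB cos2pi sin2pi mul1r mul0r sub0r mulrN.
  rewrite tail_norm_sin; last by lia.
  by rewrite -iE zi ltr0_norm// opprK.
rewrite tail_norm_sin; last by lia.
by rewrite -iE zi ger0_norm// leNgt.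
Qed.

Lemma polar_angle_domain z : angle_domain (polar z).2.
Proof.
move=> i; rewrite -tnth_nth tnth_mktuple /polar_angle.
have i_n : (i < n)%N by have := ltn_ord i; lia.
have ratio_bnd := tail_norm_ratio z i_n.
have acos_ge := acos_ge0 ratio_bnd; have acos_le := acos_lepi ratio_bnd.
have pi0 : 0 < pi :> R := pi_gt0 R.
have [iE|_] /= := eqVneq i.+2 n; last by rewrite acos_ge acos_le.
case: ifPn => z0; last by apply/andP; split=> //; lra.
suff acos_gt : 0 < acos (z`_i / tail_norm z i) by apply/andP; split; lra.
rewrite lt_def acos_ge andbT; apply: contraTneq z0 => acos0.
have := tail_norm_sin z i_n.
rewrite acos0 sin0 mulr0 /tail_norm big_ltn ?iE// big_geq ?addr0 ?sqrtr_sqr//.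
by move=> /esym/eqP; rewrite normr_eq0 => /eqP ->; rewrite ltxx.
Qed.

End polar_coordinates.

Section densities.
Context {R : realType}.

Definition is_density d (T : measurableType d)
    (m : {measure set T -> \bar R}) (nu : set T -> \bar R) (p : T -> R) :=
  [/\ measurable_fun setT p, forall x, 0 <= p x &
      forall A, measurable A -> nu A = (\int[m]_(x in A) (p x)%:E)%E].

(* The law of X conditionally on Y = y. *)
Definition class_law d (Omega : measurableType d) (P : probability Omega R)
    (T L : Type) (X : Omega -> T) (Y : Omega -> L) (y : L) : set T -> \bar R :=
  fun A => (fine (P (X @^-1` A `&` Y @^-1` [set y])) /
            fine (P (Y @^-1` [set y])))%:E.

Context {n : nat}.
Implicit Types (p : R * n.-1.-tuple R -> R) (phi : n.-1.-tuple R) (r : R).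

(* The reference measure for densities of (r, phi) is dr dphi, so that the
   Jacobian of the polar change of variables is part of the density. *)
Definition is_polar_density (nu : set (R * n.-1.-tuple R) -> \bar R) p :=
  is_density (@lebesgue_measure R \x lebesgue_tuple n.-1)%E nu p.

Definition angle_density p phi : R :=
  Rintegral (@lebesgue_measure R) `[0, +oo[ (fun r => p (r, phi)).

(* The conditional density of the norm given the angles; meaningful only where
   angle_density p phi > 0. *)
Definition norm_density p r phi : R := p (r, phi) / angle_density p phi.

Definition norm_ratio (pt p : R * n.-1.-tuple R -> R) r phi : R :=
  norm_density pt r phi / norm_density p r phi.

Definition angular_invariance N C (p : 'I_N -> 'I_C -> R * n.-1.-tuple R -> R)
    (pt : 'I_C -> R * n.-1.-tuple R -> R) :=
  forall d y phi, angle_domain phi ->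
    angle_density (p d y) phi = angle_density (pt y) phi.

Definition uniform_norm pt (alpha beta : n.-1.-tuple R -> R) :=
  forall phi, angle_domain phi -> 0 < angle_density pt phi ->
    [/\ 0 <= alpha phi, 0 < beta phi - alpha phi &
        forall r, 0 <= r ->
          norm_density pt r phi = uniform_pdf (alpha phi) (beta phi) r].

(* The rate of an exponential distribution is the inverse of its mean. *)
Definition exponential_norm p (mean : n.-1.-tuple R -> R) :=
  forall phi, angle_domain phi -> 0 < angle_density p phi ->
    0 < mean phi /\
    forall r, 0 <= r -> norm_density p r phi = exponential_pdf (mean phi)^-1 r.

Definition first_order_maclaurin (f q : R -> R) :=
  derivable f 0 1 /\ forall x, q x = f 0 + derive1 f 0 * x.

End densities.

(* Main.v *)
Require Import Defs.
From HB Require Import structures.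
From mathcomp Require Import all_boot all_order all_algebra.
From mathcomp Require Import all_classical all_reals all_analysis.
Import Order.TTheory GRing.Theory Num.Def Num.Theory.
Import numFieldNormedType.Exports.
Local Open Scope classical_set_scope.
Local Open Scope ring_scope.

(** On the support of the target norm both conditional densities are explicit, 1/delta and
    exp(-r/mu)/mu, and their quotient is mu exp(r/mu)/delta. Differentiating in r cancels the factor
    mu, leaving exp(r/mu)/delta, so the value and slope at 0 are mu/delta and 1/delta: the
    coefficients of (mu + r)/delta. *)

Lemma is_derive_expR_scaled {R : realType} (m c x : R) (hm : m != 0) :
  is_derive x 1 (fun r => m * expR (r / m) / c) (expR (x / m) / c).
Proof.
have h : is_derive x (1 : R) (fun r : R => r / m) m^-1.
  (* As a scalar multiple of [id], the map is in a form whose derivative instance inference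
     finds. *)
  have -> : (fun r : R => r / m) = m^-1 *: (@id R).
    by apply/funext => r; rewrite mulrC.
  by apply: is_derive_eq; rewrite scaler1.
have hE := @is_derive1_comp _ expR (fun r => r / m) x _ _ (is_derive_expR _) h.
have -> : (fun r => m * expR (r / m) / c) =
    (m / c) *: (expR \o (fun r => r / m)).
  by apply/funext => r /=; rewrite mulrAC.
apply: is_derive_eq.
by rewrite /GRing.scale/= mulrAC mulrCA divff// mulr1 mulrC.
Qed.

Theorem corollary1 (R : realType) (N C n : nat) (hN : (1 <= N)%N) (hn : (2 <= n)%N)
  (* labelled examples: input X, label Y, one law per domain *)
  (d1 d2 : measure_display)
  (Omega : measurableType d1) (In : measurableType d2)
  (X : Omega -> In) (hX : measurable_fun setT X)
  (Y : Omega -> 'I_C) (hY : forall y, measurable (Y @^-1` [set y]))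
  (P : 'I_N -> probability Omega R) (Pt : probability Omega R)
  (hP : forall d y, (0 < P d (Y @^-1` [set y]))%E)
  (hPt : forall y, (0 < Pt (Y @^-1` [set y]))%E)
  (* feature map into the latent space *)
  (Z : set (n.-tuple R)) (feat : In -> n.-tuple R)
  (hfeat : measurable_fun setT feat) (hZ : forall x, Z (feat x))
  (* densities of the latent laws p(z | d, y), p^t(z | y) *)
  (hlat : forall d y, exists q,
    is_density (lebesgue_tuple n) (class_law (P d) (feat \o X) Y y) q)
  (hlatt : forall y, exists q,
    is_density (lebesgue_tuple n) (class_law Pt (feat \o X) Y y) q)
  (* densities of the laws of (r, phi) *)
  (p : 'I_N -> 'I_C -> R * n.-1.-tuple R -> R)
  (pt : 'I_C -> R * n.-1.-tuple R -> R)
  (hp : forall d y,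
    is_polar_density (class_law (P d) (polar \o feat \o X) Y y) (p d y))
  (hpt : forall y,
    is_polar_density (class_law Pt (polar \o feat \o X) Y y) (pt y))
  (* (i) *)
  (hinv : angular_invariance p pt)
  (* (ii) *)
  (alpha beta delta : 'I_C -> n.-1.-tuple R -> R)
  (hdelta : forall y phi, delta y phi = beta y phi - alpha y phi)
  (mu : 'I_N -> 'I_C -> n.-1.-tuple R -> R)
  (hunif : forall y, uniform_norm (pt y) (alpha y) (beta y))
  (hexp : forall d y, exponential_norm (p d y) (mu d y)) :
  forall (d : 'I_N) (y : 'I_C) (phi : n.-1.-tuple R),
    angle_domain phi -> 0 < angle_density (pt y) phi ->
    (forall r : R, alpha y phi <= r <= beta y phi ->
      norm_ratio (pt y) (p d y) r phi =
        mu d y phi * expR (r / mu d y phi) / delta y phi) /\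
    first_order_maclaurin
      (fun r : R => mu d y phi * expR (r / mu d y phi) / delta y phi)
      (fun r : R => (mu d y phi + r) / delta y phi).
Proof.
move=> d y phi dom_phi pt_gt0.
(* Angular invariance carries positivity from target to source, so the exponential law is available
   at the same [phi]. *)
have p_gt0 : 0 < angle_density (p d y) phi by rewrite hinv.
have [alpha0 delta0 unifE] := hunif y phi dom_phi pt_gt0.
have [mu0 expE] := hexp d y phi dom_phi p_gt0.
have mu_neq0 : mu d y phi != 0 by rewrite gt_eqF.
rewrite hdelta; split=> [r r_itv|].
  (* Both density formulas are given only for nonnegative norms; here [alpha] being nonnegative
     ensures this. *)
  have r0 : 0 <= r by case/andP: r_itv => ar _; exact: le_trans ar.
  rewrite /norm_ratio unifE// expE// /uniform_pdf r_itv exponential_pdfE//.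
  (* Inverting the exponential density of rate 1/mu turns exp(-r/mu)/mu into mu exp(r/mu). *)
  by rewrite mulNr expRN (mulrC _ r) invfM !invrK [LHS]mulrC.
have dE := is_derive_expR_scaled (mu d y phi) (beta y phi - alpha y phi) 0 mu_neq0.
split=> [|x]; first exact: ex_derive.
by rewrite derive1E derive_val mul0r expR0 mulr1 mul1r mulrDl (mulrC x).
Qed.
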